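(* Let $\alpha = 2-\frac{2}{\sqrt3}$. (1) For every integer $n\ge 3$ and every matrix $U\in\mathbb{C}^{n\times 2}$ with orthonormal columns (i.e. $U^HU=I_2$), there exist distinct row indices $i\neq j$ such that the $2\times 2$ submatrix $U_{ij}$ of $U$ formed by rows $i$ and $j$ is invertible and $$\|U_{ij}^{-1}\|_2\le \sqrt{n/\alpha}.$$ (2) The bound is asymptotically tight: with $$b_n=\sup_{U\in\mathbb{C}^{n\times 2},\ U^HU=I_2}\ \min_{i\ne j}\|U_{ij}^{-1}\|_2 ,$$ one has $\lim_{n\to\infty}\frac{\sqrt{n/\alpha}}{b_n}=1$. (3) For fixed $n\ge 3$ and $U\in\mathbb{C}^{n\times 2}$ with $U^HU=I_2$, the equality $\min_{i\neq j}\|U_{ij}^{-1}\|_2=\sqrt{n/\alpha}$ holds if and only if $4\mid n$ and the Hopf images $w_1,\dots,w_n\in\mathbb{R}^3$ of the rows of $U$ are clustered into four groups, each consisting of $n/4$ identical vectors, such that the endpoints of four vectors taken one from each group form the vertices of a regular tetrahedron centered at the origin.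
   Context: $\|\cdot\|_2$ is the spectral norm (largest singular value) of a matrix, and $\|U_{ij}^{-1}\|_2$ is understood as $+\infty$ when $U_{ij}$ is singular. $U^H$ is the conjugate transpose of $U$. The Hopf map $p:\mathbb{C}^2\to\mathbb{R}^3$ is $$p(u,v)=\bigl(\bar u v+u\bar v,\ i(\bar u v-u\bar v),\ |u|^2-|v|^2\bigr)$$ (here $i$ is the imaginary unit). The Hopf image of the $k$-th row $(u_{k1},u_{k2})$ of $U$ is $w_k=p(u_{k1},u_{k2})$. *)

(* Defs.v *)
From HB Require Import structures.
From mathcomp Require Import all_boot all_order all_algebra.
From mathcomp Require Import complex ring.
From mathcomp Require Import all_classical all_reals all_analysis.
Set Implicit Arguments.
Unset Strict Implicit.
Unset Printing Implicit Defensive.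
Import Order.TTheory GRing.Theory Num.Theory.
Import numFieldNormedType.Exports.
Local Open Scope classical_set_scope.
Local Open Scope ring_scope.
Local Open Scope sesquilinear_scope.
Local Open Scope complex_scope.

(* [A ^t*] (from spectral.v) is the conjugate transpose of [A]. *)

Definition orthonormal_columns {R : realType} {m n : nat}
    (A : 'M[R[i]]_(m, n)) : Prop :=
  A ^t* *m A = 1%:M.

Definition singular_values {R : realType} {m n : nat}
    (A : 'M[R[i]]_(m, n)) : set R :=
  [set s | 0 <= s /\ eigenvalue (A ^t* *m A) (s ^+ 2)%:C].

(* For n > 0 the set of singular values is finite and nonempty, so that its
   supremum is the largest singular value. *)
Definition spectral_norm {R : realType} {m n : nat}
    (A : 'M[R[i]]_(m, n)) : R :=
  sup (singular_values A).

Definition row_pair {R : realType} {n : nat} (U : 'M[R[i]]_(n, 2))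
    (i j : 'I_n) : 'M[R[i]]_2 :=
  rowsub (tnth [tuple i; j]) U.

Definition inv_norm {R : realType} {n : nat} (A : 'M[R[i]]_n) : \bar R :=
  if A \in unitmx then (spectral_norm (invmx A))%:E else +oo%E.

Definition min_inv_norm {R : realType} {n : nat}
    (U : 'M[R[i]]_(n, 2)) : \bar R :=
  \big[mine/+oo%E]_(p : 'I_n * 'I_n | p.1 != p.2)
     inv_norm (row_pair U p.1 p.2).

(* When n < 2 there is no such U and the value is -oo. *)
Definition sup_min_inv_norm (R : realType) (n : nat) : \bar R :=
  ereal_sup [set min_inv_norm U |
             U in [set U : 'M[R[i]]_(n, 2) | orthonormal_columns U]].

Definition alpha (R : realType) : R := 2 - 2 / Num.sqrt 3.

Definition hopfC {C : numClosedFieldType} (u v : C) : 'rV[C]_3 :=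
  \row_k tnth [tuple u^* * v + u * v^*;
                     'i * (u^* * v - u * v^*);
                     `|u| ^+ 2 - `|v| ^+ 2] k.

(* The entries of [hopfC u v] are real, see [hopfE]. *)
Definition hopf {R : realType} (u v : R[i]) : 'rV[R]_3 :=
  map_mx (@complex.Re R) (hopfC u v).

Lemma hopfE (R : realType) (u v : R[i]) :
  map_mx (fun x : R => x%:C) (hopf u v) = hopfC u v.
Proof.
apply/rowP => k; rewrite !mxE !(tnth_nth 0) !normCK -complexiE.
case: u v k => [a b] [c d] [[|[|[|//]]] lt_k3]; apply/eqP;
  rewrite eq_complex /=; by apply/andP; split; apply/eqP; ring.
Qed.

Definition hopf_row {R : realType} {n : nat} (U : 'M[R[i]]_(n, 2))
    (k : 'I_n) : 'rV[R]_3 :=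
  hopf (U k 0) (U k 1).

(* The library norm on ['rV[R]_d] is the sup norm, hence this definition. *)
Definition euclidean_dist {R : realType} {d : nat} (x y : 'rV[R]_d) : R :=
  Num.sqrt (\sum_(k < d) (x 0 k - y 0 k) ^+ 2).

Definition regular_tetrahedron {R : realType} (v : 'I_4 -> 'rV[R]_3) : Prop :=
  exists2 l : R, 0 < l &
    forall a b : 'I_4, a != b -> euclidean_dist (v a) (v b) = l.

Definition centered_at_origin {R : realType} (v : 'I_4 -> 'rV[R]_3) : Prop :=
  \sum_(a < 4) v a = 0.

(* [g k] is the group of index [k] and [v c] is the common value of the
   vectors of group [c]. *)
Definition tetrahedral_clusters {R : realType} {n : nat}
    (w : 'I_n -> 'rV[R]_3) : Prop :=
  exists (g : 'I_n -> 'I_4) (v : 'I_4 -> 'rV[R]_3),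
    [/\ forall c : 'I_4, #|[set k | g k == c]%SET| = (n %/ 4)%N,
        forall k : 'I_n, w k = v (g k),
        regular_tetrahedron v &
        centered_at_origin v].

(* Main.v *)
Require Import Defs.
From HB Require Import structures.
From mathcomp Require Import all_boot all_order all_algebra.
From mathcomp Require Import complex.
From mathcomp Require Import all_classical all_reals all_analysis.
From mathcomp Require Import ring lra.
Set Implicit Arguments.
Unset Strict Implicit.
Unset Printing Implicit Defensive.
Import Order.TTheory GRing.Theory Num.Theory.
Import numFieldNormedType.Exports.
Local Open Scope classical_set_scope.
Local Open Scope ring_scope.

(* Let r_k = |w_k| be the squared norm of row k, so that sum_k w_k = 0 and
   sum_k r_k = 2. Since ||U_ij^-1||^2 = 2 / (r_i + r_j - |w_i + w_j|), one has to
   show that r_i + r_j - |w_i + w_j| <= alpha mu for all i, j, with mu = 2/n,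
   forces the tetrahedral configuration. Put w_k = r_k x_k with |x_k| = 1,
   t_ij = <x_i, x_j>, and weights p_k = r_k / 2. The assumption reads
   1 + t_ij >= y_i y_j / 6 with y_k = sqrt 3 * max(0, 2 - alpha mu / r_k), and the
   p-mean of y is at least 2. Averaging over j gives y_i <= 6 / (mean of y), so after
   scaling y down, 0 <= y <= 3 and the mean of y is exactly 2. In
     0 <= sum_ij p_i p_j (6 (1 + t_ij) - y_i y_j)
                         (12 y_i y_j (1 - t_ij) + (y_i^2 - y_j^2)^2)
   all terms that are linear in t cancel because sum_k p_k x_k = 0, and the
   quadratic ones are controlled by sum_ij p_i p_j y_i y_j t_ij^2 >= 4 / 3. This
   leaves a polynomial inequality between the moments of y of order at most 5,
   which for a measure on [0, 3] of mean 2 holds only at the constant 2. Hence all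
   terms of the double sum vanish, that is r_k = mu and t_ij is 1 or -1/3; summing
   t_ij over j shows that each vector w_i is taken exactly n/4 times. *)

(** * Moments of the weights *)

Definition moment {R : numDomainType} {I : finType} (p y : I -> R) (k : nat) : R :=
  \sum_i p i * y i ^+ k.

(** A polynomial that is nonnegative at the atoms [y i] bounds a linear form in the moments. [Q] is
    its factored form, and [c] the shape in which the bound is wanted. *)
Lemma moment_poly_ge0 (R : numDomainType) (I : finType) (p y : I -> R)
    (s : seq R) (Q : R -> R) (c : R) :
  (forall i, 0 <= p i) -> (forall x, \sum_(k < size s) s`_k * x ^+ k = Q x) ->
  (forall i, 0 <= Q (y i)) -> \sum_(k < size s) s`_k * moment p y k = c -> 0 <= c.
Proof.
move=> p0 sQ Q0 <-; rewrite (_ : \sum_(k < _) _ = \sum_i p i * Q (y i)).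
  by apply: sumr_ge0 => i _; rewrite mulr_ge0.
under [RHS]eq_bigr do rewrite -sQ mulr_sumr.
rewrite exchange_big /=; apply: eq_bigr => i _; rewrite mulr_sumr.
by apply: eq_bigr => k _; rewrite mulrCA.
Qed.

(** Here [d] stands for [y - 2], and the last hypothesis is [0 <= f] of [simplex_rigidity] in
    centered moments. Were the variance positive, lower bounds on the moments of order 4 and 5 would
    make that expression negative. *)
Lemma centered_variance_eq0 (R : realFieldType) (I : finType) (p d : I -> R)
    (m := moment p d) :
  (forall i, 0 <= p i) -> (forall i, -2 <= d i <= 1) ->
  m 0%N = 1 -> m 1%N = 0 ->
  0 <= - 16 * m 2%N - 16 * m 3%N - 14 * m 4%N - 2 * m 5%N
       + 24 * m 2%N ^+ 2 + 12 * m 2%N * m 3%N + m 3%N ^+ 2 ->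
  m 2%N = 0.
Proof.
move=> p0 dI m0 m1 f0.
have v_ge0 : 0 <= m 2%N by apply: sumr_ge0 => i _; rewrite mulr_ge0 ?sqr_ge0.
apply/eqP; rewrite -[_ == 0]negbK; apply/negP => v_neq0.
have {v_ge0 v_neq0} v_gt0 : 0 < m 2%N by rewrite lt_neqAle eq_sym v_neq0.
have [e m3E] : exists e, m 3%N = e * m 2%N.
  by exists (m 3%N / m 2%N); rewrite divfK ?gt_eqF.
have [v vE] : exists v, m 2%N = v by exists (m 2%N).
rewrite m3E vE in f0; rewrite vE in v_gt0.
(* [x ^+ 2 - e * x - v] vanishes at both atoms of the centered two-point
   measure with second and third moments [v] and [e * v]. *)
have h1 : 0 <= m 5%N - 2 * e * m 4%N + e ^+ 3 * v
    + 2 * (m 4%N - e ^+ 2 * v - v ^+ 2).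
  apply: (@moment_poly_ge0 _ _ p d
    [:: 2 * v ^+ 2; v ^+ 2 + 4 * e * v; 2 * e * v + 2 * (e ^+ 2 - 2 * v);
        e ^+ 2 - 2 * v - 4 * e; 2 - 2 * e; 1]
    (fun x => (x + 2) * (x ^+ 2 - e * x - v) ^+ 2)) => // [x|i|].
  - by rewrite !big_ord_recl big_ord0 /= /bump /=; ring.
  - by have /andP[? ?] := dI i; rewrite mulr_ge0 ?sqr_ge0 //; lra.
  - by rewrite !big_ord_recl big_ord0 /= -/m m0 m1 m3E vE /m; ring.
have h2 : 0 <= m 4%N - e ^+ 2 * v - v ^+ 2.
  apply: (@moment_poly_ge0 _ _ p d
    [:: v ^+ 2; 2 * e * v; e ^+ 2 - 2 * v; - 2 * e; 1]
    (fun x => (x ^+ 2 - e * x - v) ^+ 2)) => // [x|i|].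
  - by rewrite !big_ord_recl big_ord0 /= /bump /=; ring.
  - exact: sqr_ge0.
  - by rewrite !big_ord_recl big_ord0 /= -/m m0 m1 m3E vE /m; ring.
(* The roots [1] and [- v] are the atoms of the centered two-point measure of variance [v] that
   charges the right end. *)
have h3 : 0 <= v * (1 - v - e).
  apply: (@moment_poly_ge0 _ _ p d [:: v ^+ 2; 2 * v - v ^+ 2; 1 - 2 * v; - 1]
    (fun x => (1 - x) * (x + v) ^+ 2)) => // [x|i|].
  - by rewrite !big_ord_recl big_ord0 /= /bump /=; ring.
  - by have /andP[? ?] := dI i; rewrite mulr_ge0 ?sqr_ge0 //; lra.
  - by rewrite !big_ord_recl big_ord0 /= -/m m0 m1 m3E vE /m; ring.
have h4 : 0 <= v * (e + 2).
  apply: (@moment_poly_ge0 _ _ p d [:: 0; 0; 2; 1]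
    (fun x => (x + 2) * x ^+ 2)) => // [x|i|].
  - by rewrite !big_ord_recl big_ord0 /= /bump /=; ring.
  - by have /andP[? ?] := dI i; rewrite mulr_ge0 ?sqr_ge0 //; lra.
  - by rewrite !big_ord_recl big_ord0 /= -/m m0 m1 m3E vE /m; ring.
rewrite pmulr_rge0 // in h3; rewrite pmulr_rge0 // in h4.
(* The hypothesis, [h1] and [h2] give [0 <= Q0 + v * L], which is affine in [v]
   and negative at the ends [0] and [1 - e] of the range of [v]. *)
set Q0 := - 16 - 16 * e - 14 * e ^+ 2 - 2 * e ^+ 3.
set L := 10 + 8 * e + e ^+ 2.
have Q_ge0 : 0 <= Q0 + v * L.
  rewrite -(pmulr_rge0 _ v_gt0).
  (* Once [h1] has bounded [m 5], the coefficient of [m 4] is [- (10 + 4 * e)], negative because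
     [-2 <= e]. *)
  have : 0 <= (10 + 4 * e) * (m 4%N - e ^+ 2 * v - v ^+ 2).
    by apply: mulr_ge0 => //; lra.
  by rewrite /Q0 /L; lra.
(* [Q0 = - 2 e^2 (e + 2) - 2/5 (5 e + 4)^2 - 48/5], and [Q0 + (1 - e) L = - 3 e^2 (e + 2) - 3 (5 e^2
   + 6 e + 2)]. *)
have e2 : 0 <= e ^+ 2 * (e + 2) by rewrite mulr_ge0 ?sqr_ge0.
have e5 := sqr_ge0 (5 * e + 4).
have Q0_lt0 : Q0 < 0 by rewrite /Q0; nra.
have Q1_lt0 : Q0 + (1 - e) * L < 0 by rewrite /Q0 /L; nra.
have : 0 <= (1 - e) * (Q0 + v * L) by apply: mulr_ge0 => //; lra.
rewrite (_ : _ * _ = (1 - v - e) * Q0 + v * (Q0 + (1 - e) * L)); last by ring.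
apply/negP; rewrite -ltNge ltr_wnDl ?pmulr_rlt0 //.
by rewrite mulr_ge0_le0 // ltW.
Qed.

(** * Rigidity of vectors in three-space *)

(** A kernel that is a finite sum of products integrates to products of single sums; the list [s]
    lets an expanded polynomial kernel be treated by computation. *)
Lemma double_sum_kernel (R : comNzRingType) (I : finType) (p : I -> R)
    (s : seq ((I -> R) * (I -> R))) :
  \sum_i \sum_j p i * p j * (\sum_(f <- s) f.1 i * f.2 j)
    = \sum_(f <- s) (\sum_i p i * f.1 i) * (\sum_i p i * f.2 i).
Proof.
transitivity (\sum_i \sum_j \sum_(f <- s) p i * f.1 i * (p j * f.2 j)).
  apply: eq_bigr => i _; apply: eq_bigr => j _; rewrite mulr_sumr.
  by apply: eq_bigr => f _; rewrite mulrACA.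
under eq_bigr do rewrite exchange_big /=.
rewrite exchange_big /=; apply: eq_bigr => f _.
by rewrite mulr_suml; apply: eq_bigr => i _; rewrite mulr_sumr.
Qed.

Lemma moment_center (R : realFieldType) (I : finType) (p y : I -> R)
    (m := moment p y) :
  m 0%N = 1 -> m 1%N = 2 ->
  [/\ moment p (fun i => y i - 2) 0 = 1, moment p (fun i => y i - 2) 1 = 0,
      moment p (fun i => y i - 2) 2 = m 2%N - 4 &
      moment p (fun i => y i - 2) 3 = m 3%N - 6 * m 2%N + 16] /\
  moment p (fun i => y i - 2) 4 = m 4%N - 8 * m 3%N + 24 * m 2%N - 48 /\
  moment p (fun i => y i - 2) 5 = m 5%N - 10 * m 4%N + 40 * m 3%N - 80 * m 2%N + 128.
Proof.
move=> m0 m1.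
pose mm := moment p (fun i => y i - 2).
have h0 : mm 0%N = 1 by rewrite -m0; apply: eq_bigr => i _; rewrite !expr0.
have h1 : mm 1%N = m 1%N + (- 2) * m 0%N.
  by rewrite /m /moment !mulr_sumr -!big_split; apply: eq_bigr => i _ /=; ring.
have h2 : mm 2%N = m 2%N + (- 4) * m 1%N + 4 * m 0%N.
  by rewrite /m /moment !mulr_sumr -!big_split; apply: eq_bigr => i _ /=; ring.
have h3 : mm 3%N = m 3%N + (- 6) * m 2%N + 12 * m 1%N + (- 8) * m 0%N.
  by rewrite /m /moment !mulr_sumr -!big_split; apply: eq_bigr => i _ /=; ring.
have h4 : mm 4%N = m 4%N + (- 8) * m 3%N + 24 * m 2%N + (- 32) * m 1%N + 16 * m 0%N.
  by rewrite /m /moment !mulr_sumr -!big_split; apply: eq_bigr => i _ /=; ring.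
have h5 : mm 5%N = m 5%N + (- 10) * m 4%N + 40 * m 3%N + (- 80) * m 2%N + 80 * m 1%N + (- 32) * m 0%N.
  by rewrite /m /moment !mulr_sumr -!big_split; apply: eq_bigr => i _ /=; ring.
rewrite -!/(mm _) h0 h1 h2 h3 h4 h5 m0 m1.
by (split; last split); [split|..]; ring.
Qed.

(** The double sum of [F >= 0] is [2 * f - 72 * (Q - 4 / 3)] with [Q >= 4 / 3], so [f >= 0], which
    forces [y = 2] where [p] is nonzero. Then [f = 0], and every weighted [F i j] vanishes. *)
Lemma simplex_rigidity (R : realFieldType) (I : finType)
    (p y a b c : I -> R) (t := fun i j => a i * a j + b i * b j + c i * c j) :
  (forall i, 0 <= p i) -> \sum_i p i = 1 ->
  (forall i, t i i = 1) ->
  \sum_i p i * a i = 0 -> \sum_i p i * b i = 0 -> \sum_i p i * c i = 0 ->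
  (forall i, 0 <= y i <= 3) -> \sum_i p i * y i = 2 ->
  (forall i j, y i * y j <= 6 * (1 + t i j)) ->
  (forall i, p i != 0 -> y i = 2) /\
  (forall i j, p i != 0 -> p j != 0 -> t i j = 1 \/ t i j = - 3^-1).
Proof.
move=> p0 p1 tii Ea Eb Ec yI Ey yt.
pose m := moment p y.
have m0 : m 0%N = 1 by rewrite -p1; apply: eq_bigr => i _; rewrite expr0 mulr1.
have m1 : m 1%N = 2 by rewrite -Ey; apply: eq_bigr => i _; rewrite expr1.
have t_le1 i j : t i j <= 1.
  have := tii i; have := tii j; rewrite /t.
  have := sqr_ge0 (a i - a j); have := sqr_ge0 (b i - b j).
  by have := sqr_ge0 (c i - c j); lra.
(* The last square is what cancels the first harmonic [| \sum_i p i y i ^+ 2 x i | ^+ 2]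
   left over by the factor [1 - t i j], where [x i = (a i, b i, c i)]. *)
pose F i j := (6 * (1 + t i j) - y i * y j) *
  (12 * (y i * y j) * (1 - t i j) + (y i ^+ 2 - y j ^+ 2) ^+ 2).
have F0 i j : 0 <= F i j.
  rewrite mulr_ge0 ?subr_ge0 // addr_ge0 ?sqr_ge0 // !mulr_ge0 ?subr_ge0 //.
  - by have /andP[] := yI i.
  - by have /andP[] := yI j.
pose q (u v : I -> R) := \sum_i p i * (y i * (u i * v i)).
pose Q := q a a ^+ 2 + q b b ^+ 2 + q c c ^+ 2
  + 2 * (q a b ^+ 2 + q a c ^+ 2 + q b c ^+ 2).
pose f := 96 + m 3%N ^+ 2 + 6 * m 4%N - 2 * m 5%N - 12 * m 2%N ^+ 2.
have sumF : \sum_i \sum_j p i * p j * F i j = 2 * f - 72 * (Q - 4 / 3).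
  (* The terms of [F i j] linear in [t] reduce to [6 (y_i^4 + y_j^4) t_ij]; they sum to 0 because
     [a], [b], [c] have [p]-mean 0. *)
  pose s : seq ((I -> R) * (I -> R)) := [::
    (fun i => 72 * y i, y);
    (fun i => - 72 * (y i * (a i * a i)), fun i => y i * (a i * a i));
    (fun i => - 72 * (y i * (b i * b i)), fun i => y i * (b i * b i));
    (fun i => - 72 * (y i * (c i * c i)), fun i => y i * (c i * c i));
    (fun i => - 144 * (y i * (a i * b i)), fun i => y i * (a i * b i));
    (fun i => - 144 * (y i * (a i * c i)), fun i => y i * (a i * c i));
    (fun i => - 144 * (y i * (b i * c i)), fun i => y i * (b i * c i));
    (fun i => 6 * y i ^+ 4, fun=> 1); (fun=> 6, fun i => y i ^+ 4);
    (fun i => - 24 * y i ^+ 2, fun i => y i ^+ 2);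
    (fun i => 6 * (y i ^+ 4 * a i), a); (a, fun i => 6 * (y i ^+ 4 * a i));
    (fun i => 6 * (y i ^+ 4 * b i), b); (b, fun i => 6 * (y i ^+ 4 * b i));
    (fun i => 6 * (y i ^+ 4 * c i), c); (c, fun i => 6 * (y i ^+ 4 * c i));
    (fun i => - 1 * y i ^+ 5, y); (y, fun i => - 1 * y i ^+ 5);
    (fun i => 2 * y i ^+ 3, fun i => y i ^+ 3)].
  transitivity (\sum_i \sum_j p i * p j * (\sum_(g <- s) g.1 i * g.2 j)).
    apply: eq_bigr => i _; apply: eq_bigr => j _; congr (_ * _).
    by rewrite /s !big_cons big_nil /= /F /t; ring.
  rewrite double_sum_kernel /s !big_cons big_nil /=.
  have Z k (g : I -> R) : \sum_i p i * (k * g i) = k * \sum_i p i * g i.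
    by rewrite mulr_sumr; apply: eq_bigr => i _; rewrite mulrCA.
  have Zc k : \sum_i p i * k = k by rewrite -mulr_suml p1 mul1r.
  by rewrite !Z !Zc Ea Eb Ec Ey /f /Q /q /m /moment; field.
(* [Q] is the squared Frobenius norm of a symmetric 3 x 3 matrix of trace 2. *)
have Q_ge : 0 <= Q - 4 / 3.
  have trQ : q a a + q b b + q c c = 2.
    rewrite -Ey -!big_split; apply: eq_bigr => i _ /=.
    by rewrite -!mulrDr -/(t i i) tii mulr1.
  rewrite /Q; have := sqr_ge0 (q a b); have := sqr_ge0 (q a c).
  have := sqr_ge0 (q b c); have := sqr_ge0 (q a a - q b b).
  have := sqr_ge0 (q a a - q c c); have := sqr_ge0 (q b b - q c c).
  have : (q a a + q b b + q c c) ^+ 2 = 4 by rewrite trQ; ring.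
  lra.
have pF0 i j : 0 <= p i * p j * F i j by rewrite mulr_ge0 // mulr_ge0.
have f_ge0 : 0 <= f.
  have : 0 <= \sum_i \sum_j p i * p j * F i j.
    by apply: sumr_ge0 => i _; apply: sumr_ge0.
  by rewrite sumF; lra.
have [[d0 d1 d2 d3] [d4 d5]] := moment_center m0 m1.
have v0 : moment p (fun i => y i - 2) 2 = 0.
  apply: centered_variance_eq0 => //.
    by move=> i; have := yI i; lra.
  rewrite d2 d3 d4 d5 -/m; move: f_ge0; rewrite /f; lra.
have y2 i : p i != 0 -> y i = 2.
  move=> pi0; have : \sum_i p i * (y i - 2) ^+ 2 == 0 by apply/eqP.
  rewrite psumr_eq0 => [|k _]; last by apply: mulr_ge0 => //; exact: sqr_ge0.
  move=> /allP/(_ i (mem_index_enum _)).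
  by rewrite mulf_eq0 (negPf pi0) /= sqrf_eq0 subr_eq0 => /eqP.
split=> // i j pi0 pj0.
have mE k : m k = 2 ^+ k.
  rewrite -[RHS]mul1r -[X in X * _]p1 mulr_suml; apply: eq_bigr => l _.
  by have [->|pl0] := eqVneq (p l) 0; [rewrite !mul0r|rewrite y2].
have f_eq0 : f = 0 by rewrite /f !mE; ring.
have : \sum_i \sum_j p i * p j * F i j == 0.
  rewrite eq_le; apply/andP; split.
    by rewrite sumF f_eq0; lra.
  by apply: sumr_ge0 => k _; apply: sumr_ge0.
rewrite psumr_eq0 => [|k _]; last exact: sumr_ge0.
move=> /allP/(_ i (mem_index_enum _)) /=; rewrite psumr_eq0 //.
move=> /allP/(_ j (mem_index_enum _)) /=.
(* At [y = 2] the factors of [F i j] are [6 (1 + t) - 4] and [48 (1 - t)]. *)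
rewrite !mulf_eq0 (negPf pi0) (negPf pj0) /= y2 // y2 // subrr expr0n addr0.
case/orP=> [/eqP h|]; first by right; lra.
by rewrite mulf_eq0 => /orP[/eqP|/eqP] h; [exfalso; lra|left; lra].
Qed.

Lemma gap_rigidity (R : rcfType) (I : finType) (r a b c : I -> R) (mu : R)
    (al := 2 - 2 / Num.sqrt 3)
    (dot := fun i j => a i * a j + b i * b j + c i * c j) :
  0 < mu -> (forall i, 0 <= r i) -> (forall i, r i ^+ 2 = dot i i) ->
  \sum_i r i = #|I|%:R * mu ->
  \sum_i a i = 0 -> \sum_i b i = 0 -> \sum_i c i = 0 ->
  (forall i j, r i + r j - al * mu
     <= Num.sqrt ((a i + a j) ^+ 2 + (b i + b j) ^+ 2 + (c i + c j) ^+ 2)) ->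
  (forall i, r i = mu) /\
  (forall i j, dot i j = mu ^+ 2 \/ dot i j = - (mu ^+ 2 / 3)).
Proof.
move=> mu_gt0 r0 rE sumr suma sumb sumc gap.
have [I0|] := posnP #|I|; first by split=> i; have := fintype0 i I0.
rewrite -(ltr0n R) => N_gt0; set N : R := #|I|%:R in sumr N_gt0.
set S : R := N * mu in sumr; have S_gt0 : 0 < S by rewrite mulr_gt0.
set s : R := Num.sqrt 3.
have s_gt0 : 0 < s by rewrite sqrtr_gt0.
have s2 : s ^+ 2 = 3 by rewrite sqr_sqrtr.
have alE : s * (2 - al) = 2.
  by rewrite /al -/s opprB addrCA subrr addr0 mulrCA divff ?mulr1 // gt_eqF.
have s_gt1 : 1 < s by nra.
have al_gt0 : 0 < al by nra.
have r_eq0 i : r i = 0 -> [/\ a i = 0, b i = 0 & c i = 0].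
  move=> ri0; have := rE i; rewrite ri0 expr0n /= /dot -!expr2 => /esym h.
  have := sqr_ge0 (a i); have := sqr_ge0 (b i); have := sqr_ge0 (c i).
  by move=> *; split; apply/eqP; rewrite -sqrf_eq0; apply/eqP; lra.
pose p i := r i / S.
(* The defaults give a zero vector the direction [(1, 0, 0)], so that [t i i = 1] for every [i]; its
   weight [p i] is 0. *)
pose nrm (d : R) (u : I -> R) i := if r i == 0 then d else u i / r i.
pose x := nrm 1 a; pose y := nrm 0 b; pose z := nrm 0 c.
pose t i j := x i * x j + y i * y j + z i * z j.
(* With [g i = 0] for [2 * r i <= al * mu], the gap condition on [i], [j] becomes
   the product bound [gt6] below. *)
pose g i := if r i == 0 then 0 else s * Num.max 0 (2 - al * mu / r i).
have p0 i : 0 <= p i by rewrite divr_ge0 // ltW.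
have p1 : \sum_i p i = 1 by rewrite -mulr_suml sumr divff // gt_eqF.
have p_eq0 i : (p i == 0) = (r i == 0).
  by rewrite mulf_eq0 invr_eq0 (gt_eqF S_gt0) orbF.
have tii i : t i i = 1.
  rewrite /t /x /y /z /nrm; case: eqVneq => [_|ri0]; first by ring.
  by rewrite -[RHS](@divff _ (r i ^+ 2)) ?sqrf_eq0 // [X in _ = X / _]rE /dot; field.
have centered d u : (forall i, r i = 0 -> u i = 0) -> \sum_i u i = 0 ->
    \sum_i p i * nrm d u i = 0.
  move=> u0 sumu; transitivity (\sum_i u i / S); last by rewrite -mulr_suml sumu mul0r.
  apply: eq_bigr => i _; rewrite /p /nrm; case: eqVneq => [ri0|ri0].
    by rewrite ri0 u0 // !mul0r.
  by field; rewrite ri0 gt_eqF.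
have Ex : \sum_i p i * x i = 0 by apply: centered => // i /r_eq0[].
have Ey : \sum_i p i * y i = 0 by apply: centered => // i /r_eq0[].
have Ez : \sum_i p i * z i = 0 by apply: centered => // i /r_eq0[].
have g0 i : 0 <= g i.
  by rewrite /g; case: ifP => // _; rewrite mulr_ge0 ?(ltW s_gt0) // le_max lexx.
have t_geN1 i j : 0 <= 1 + t i j.
  have := tii i; have := tii j; rewrite /t.
  have := sqr_ge0 (x i + x j); have := sqr_ge0 (y i + y j).
  by have := sqr_ge0 (z i + z j); lra.
have gt6 i j : g i * g j <= 6 * (1 + t i j).
  have T : 0 <= 6 * (1 + t i j) by rewrite mulr_ge0.
  have [gi0|gi_neq0] := eqVneq (g i) 0; first by rewrite gi0 mul0r.
  have [gj0|gj_neq0] := eqVneq (g j) 0; first by rewrite gj0 mulr0.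
  have gpos k : g k != 0 -> [/\ 0 < r k, al * mu < 2 * r k &
      g k = s * (2 * r k - al * mu) / r k].
    rewrite /g; case: (eqVneq (r k) 0) => [_|rk0]; first by rewrite eqxx.
    have rk_gt0 : 0 < r k by rewrite lt_neqAle eq_sym rk0 r0.
    have [h|h] := ltP 0 (2 - al * mu / r k); last first.
      by rewrite mulr0 eqxx.
    move=> _; split=> //; last by field.
    by move: h; rewrite subr_gt0 ltr_pdivrMr.
  have [ri_gt0 ri_big giE] := gpos i gi_neq0.
  have [rj_gt0 rj_big gjE] := gpos j gj_neq0.
  have tE : t i j = dot i j / (r i * r j).
    rewrite /t /x /y /z /nrm !gt_eqF // /dot.
    by field; rewrite !gt_eqF.
  rewrite giE gjE tE.
  have -> : s * (2 * r i - al * mu) / r i * (s * (2 * r j - al * mu) / r j) =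
    s ^+ 2 * ((2 * r i - al * mu) * (2 * r j - al * mu)) / (r i * r j).
    by field; rewrite !gt_eqF.
  rewrite ler_pdivrMr ?mulr_gt0 // s2.
  have -> : 6 * (1 + dot i j / (r i * r j)) * (r i * r j) = 6 * (r i * r j + dot i j).
    by field; rewrite !gt_eqF.
  (* This sign allows squaring the gap condition, which becomes [(2 r_i - al mu) (2 r_j - al mu) <=
     2 (r_i r_j + dot i j)]. *)
  have u_ge0 : 0 <= r i + r j - al * mu by lra.
  have := gap i j; rewrite -ler_sqr ?nnegrE ?sqrtr_ge0 //.
  rewrite sqr_sqrtr ?addr_ge0 ?sqr_ge0 //.
  have := rE i; have := rE j; rewrite /dot; nra.
pose A := \sum_i p i * g i.
(* Dropping the maximum with 0 can only lower the mean, and what remains averages to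
   [s * (2 - al) = 2]. *)
have A_ge2 : 2 <= A.
  have -> : 2 = \sum_i (s * (2 * r i - al * mu) / S).
    rewrite -mulr_suml -mulr_sumr sumrB -mulr_sumr sumr sumr_const -(mulr_natr (al * mu)) -/N.
    by rewrite -[LHS]alE /S; field; rewrite !gt_eqF.
  apply: ler_sum => i _; rewrite /p /g; case: eqVneq => [->|ri0].
    rewrite mul0r mul0r mulr0 sub0r mulrN mulNr oppr_le0.
    by rewrite divr_ge0 ?mulr_ge0 ?(ltW s_gt0) ?(ltW al_gt0) ?(ltW mu_gt0) ?(ltW S_gt0).
  have ri_gt0 : 0 < r i by rewrite lt_neqAle eq_sym ri0 r0.
  rewrite (_ : s * _ / S = r i / S * (s * (2 - al * mu / r i))); last first.
    by field; rewrite ri0 gt_eqF.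
  by rewrite ler_pM2l ?divr_gt0 // ler_pM2l // le_max lexx orbT.
have A_gt0 : 0 < A by lra.
have gA i : g i * A <= 6.
  rewrite -subr_ge0 (_ : _ - _ = \sum_j p j * (6 * (1 + t i j) - g i * g j)).
    by apply: sumr_ge0 => j _; rewrite mulr_ge0 // subr_ge0.
  rewrite (eq_bigr (fun j => 6 * p j + 6 * x i * (p j * x j) + 6 * y i * (p j * y j)
    + 6 * z i * (p j * z j) - g i * (p j * g j))); last first.
    by move=> j _; rewrite /t; ring.
  by rewrite sumrB !big_split /= -!mulr_sumr Ex Ey Ez p1 !mulr0 !addr0 mulr1.
(* The rescaled [g] has mean 2. As [2 <= A], the product bound survives, and [gA] gives
   [2 * g i / A <= 12 / A ^+ 2 <= 3]. *)
have [] := @simplex_rigidity _ I p (fun i => 2 * g i / A) x y z p0 p1 tii Ex Ey Ez.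
- move=> i; rewrite divr_ge0 ?mulr_ge0 ?(ltW A_gt0) //= ler_pdivrMr //.
  have := gA i; have := g0 i; nra.
- under eq_bigr do rewrite mulrA mulrCA mulrA.
  rewrite -mulr_suml.
  under eq_bigr do rewrite -mulrA.
  by rewrite -mulr_sumr -/A; field; rewrite gt_eqF.
- move=> i j; apply: le_trans (gt6 i j).
  rewrite [leLHS](_ : _ = 4 * (g i * g j) / A ^+ 2); last by field; rewrite gt_eqF.
  rewrite ler_pdivrMr ?exprn_gt0 // mulrC ler_wpM2l ?mulr_ge0 //.
  nra.
move=> gE tE.
have gA' i : r i != 0 -> g i = A.
  rewrite -p_eq0 => /gE h.
  have -> : g i = 2 * g i / A * (A / 2) by field; rewrite gt_eqF.
  by rewrite h; field.
have [i ri0] : exists i, r i != 0.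
  apply/existsP; rewrite -[X in is_true X]negbK negb_exists; apply/negP => /forallP h.
  move: p1; rewrite big1 => [/eqP|i _]; first by rewrite eq_sym oner_eq0.
  by apply/eqP; rewrite p_eq0; have := h i; rewrite negbK.
(* Were [t i j = 1] on the whole support, its mean over [j] would be 1, but centering makes it 0. *)
have [j rj0 tij] : exists2 j, r j != 0 & t i j = - 3^-1.
  have [/existsP[j /andP[? /eqP ?]]|] := boolP [exists j, (r j != 0) && (t i j == - 3^-1)].
    by exists j.
  rewrite negb_exists => /forallP h; exfalso.
  have : \sum_j p j * t i j = 1.
    rewrite -[RHS]p1; apply: eq_bigr => j _.
    have [->|pj0] := eqVneq (p j) 0; first by rewrite mul0r.
    have [->|tij] : t i j = 1 \/ t i j = - 3^-1 by apply: tE => //; rewrite p_eq0.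
      by rewrite mulr1.
    by have := h j; rewrite -p_eq0 pj0 tij eqxx.
  rewrite (eq_bigr (fun j => x i * (p j * x j) + y i * (p j * y j)
    + z i * (p j * z j))); last by move=> j _; rewrite /t; ring.
  rewrite !big_split /= -!mulr_sumr Ex Ey Ez !mulr0 !addr0 => /eqP.
  by rewrite eq_sym oner_eq0.
(* At this pair [gt6] reads [A^2 <= 6 (1 - 1/3) = 4]. *)
have A2 : A = 2.
  apply/eqP; rewrite eq_le A_ge2 andbT.
  have := gt6 i j; rewrite gA' // gA' // tij; nra.
(* Compare [g k = s * (2 - al * mu / r k)] with [2 = s * (2 - al)]. *)
have r_mu k : r k != 0 -> r k = mu.
  move=> rk0; have rk_gt0 : 0 < r k by rewrite lt_neqAle eq_sym rk0 r0.
  have gk := gA' k rk0; rewrite A2 /g (negPf rk0) in gk.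
  have [h|h] := ltP 0 (2 - al * mu / r k); last first.
    by move: gk; rewrite max_l // mulr0 => /eqP; rewrite eq_sym pnatr_eq0.
  move: gk; rewrite max_r ?ltW // -[in RHS]alE => /(mulfI (lt0r_neq0 s_gt0)).
  move=> /addrI/oppr_inj h'.
  apply: (mulfI (lt0r_neq0 al_gt0)).
  by rewrite -[in LHS]h' divfK.
(* No length exceeds [mu] and they sum to [N * mu], so none is 0. *)
have rmu k : r k = mu.
  have r_le k' : r k' <= mu.
    by have [->|/r_mu->] := eqVneq (r k') 0; rewrite // ltW.
  apply/eqP; rewrite -subr_eq0 -oppr_eq0 opprB.
  have : \sum_k' (mu - r k') == 0.
    by rewrite sumrB sumr sumr_const -(mulr_natl mu) subrr.
  rewrite psumr_eq0 => [|k' _]; last by rewrite subr_ge0.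
  by move=> /allP/(_ k (mem_index_enum _)).
split=> // k l.
have : t k l = 1 \/ t k l = - 3^-1 by apply: tE; rewrite p_eq0 rmu gt_eqF.
have -> : dot k l = mu ^+ 2 * t k l.
  rewrite /dot /t /x /y /z /nrm !rmu (gt_eqF mu_gt0).
  by field; rewrite gt_eqF.
by case=> ->; [left|right]; rewrite ?mulr1 ?mulrN.
Qed.

(** * Singular values of 2 x 2 matrices *)

Lemma det_mx22 (S : comNzRingType) (A : 'M[S]_2) :
  \det A = A 0 0 * A 1 1 - A 0 1 * A 1 0.
Proof.
rewrite (expand_det_row _ 0) !big_ord_recl big_ord0 addr0 /cofactor !det_mx11 !mxE.
have -> : lift (0 : 'I_2) 0 = 1 by exact/val_inj.
have -> : lift (1 : 'I_2) 0 = 0 by exact/val_inj.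
by rewrite /= expr0 expr1; ring.
Qed.

Lemma eigenvalue_det (F : fieldType) (n : nat) (A : 'M[F]_n) (x : F) :
  eigenvalue A x = (\det (A - x%:M) == 0).
Proof.
by rewrite /eigenvalue /eigenspace kermx_eq0 row_free_unit unitmxE unitfE negbK.
Qed.

(** Takes values in [R], whereas the square of the library modulus lies in [R[i]]. *)
Definition sqmod {R : rcfType} (z : R[i]) : R := complex.Re z ^+ 2 + complex.Im z ^+ 2.

Lemma sqmod_ge0 (R : rcfType) (z : R[i]) : 0 <= sqmod z.
Proof. by rewrite addr_ge0 ?sqr_ge0. Qed.

Lemma sqmodE (R : rcfType) (z : R[i]) : (sqmod z)%:C%C = z^* * z.
Proof.
by case: z => a b; apply/eqP; rewrite eq_complex /sqmod /=; apply/andP; split; apply/eqP; ring.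
Qed.

Lemma sqmod_eq0 (R : rcfType) (z : R[i]) : (sqmod z == 0) = (z == 0).
Proof.
rewrite eq_complex /sqmod paddr_eq0 ?sqr_ge0 //.
by rewrite !sqrf_eq0.
Qed.

Lemma sqmodM (R : rcfType) (x y : R[i]) : sqmod (x * y) = sqmod x * sqmod y.
Proof. by rewrite /sqmod; case: x y => [a a'] [b b'] /=; ring. Qed.

Lemma sqmod0 (R : rcfType) : sqmod (0 : R[i]) = 0.
Proof. by rewrite /sqmod /= expr0n addr0. Qed.

Definition sqfrob {R : rcfType} (A : 'M[R[i]]_2) : R :=
  (sqmod (A 0 0) + sqmod (A 0 1)) + (sqmod (A 1 0) + sqmod (A 1 1)).

(** This is the reversed characteristic polynomial of the Gram matrix, whose trace is [sqfrob A] and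
    determinant [sqmod (\det A)]. *)
Lemma det_one_sub_gram (R : rcfType) (A : 'M[R[i]]_2) (x : R[i]) :
  \det (1%:M - x *: ((A ^t*)%sesqui *m A)) =
  x ^+ 2 * (sqmod (\det A))%:C%C - x * (sqfrob A)%:C%C + 1.
Proof.
have -> : (sqfrob A)%:C%C = (A 0 0)^* * A 0 0 + (A 0 1)^* * A 0 1
    + ((A 1 0)^* * A 1 0 + (A 1 1)^* * A 1 1).
  by rewrite -!sqmodE -!rmorphD.
rewrite sqmodE !det_mx22 !mxE !big_ord_recl !big_ord0 !mxE /=.
have -> : lift (0 : 'I_2) 0 = 1 by exact/val_inj.
rewrite rmorphB !rmorphM /=.
ring.
Qed.

(** Multiplying by [A ^t*] on the left and [A] on the right turns the characteristic matrix for
    [invmx A] into [1 - x A ^t* A], so no inverse is computed. *)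
Lemma eigenvalue_inv_gram (R : rcfType) (A : 'M[R[i]]_2) (x : R) :
  A \in unitmx ->
  eigenvalue (((invmx A) ^t*)%sesqui *m invmx A) x%:C%C =
  (x ^+ 2 * sqmod (\det A) - x * sqfrob A + 1 == 0).
Proof.
move=> Au; have dA : \det A != 0 by rewrite -unitfE -unitmxE.
rewrite eigenvalue_det.
have AhNh : (A ^t*)%sesqui *m ((invmx A) ^t*)%sesqui = 1%:M.
  by rewrite -map_mxM -trmx_mul mulVmx // trmx1 map_mx1.
have h : (A ^t*)%sesqui *m (((invmx A) ^t*)%sesqui *m invmx A - x%:C%C%:M) *m A =
   1%:M - x%:C%C *: ((A ^t*)%sesqui *m A).
  rewrite mulmxBr mulmxBl mulmxA AhNh mul1mx mulVmx //.
  by rewrite mul_mx_scalar scalemxAl.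
have := congr1 determinant h; rewrite !det_mulmx det_one_sub_gram.
rewrite det_map_mx det_tr => e.
have -> : (x ^+ 2 * sqmod (\det A) - x * sqfrob A + 1 == 0) =
  ((x%:C%C) ^+ 2 * (sqmod (\det A))%:C%C - x%:C%C * (sqfrob A)%:C%C + 1 == 0).
  rewrite -rmorphXn -!rmorphM -rmorphB -(rmorph1 (real_complex R)) -rmorphD /=.
  by rewrite eq_complex /= eqxx andbT.
by rewrite -e !mulf_eq0 (negPf dA) conjC_eq0 (negPf dA) orbF.
Qed.

(* Twice the smallest eigenvalue of [A ^t* *m A]. *)
Definition gap2 {R : rcfType} (A : 'M[R[i]]_2) : R :=
  sqfrob A - Num.sqrt (sqfrob A ^+ 2 - 4 * sqmod (\det A)).

Lemma gap2_discr_ge0 (R : rcfType) (A : 'M[R[i]]_2) :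
  0 <= sqfrob A ^+ 2 - 4 * sqmod (\det A).
Proof.
rewrite det_mx22 /sqfrob /sqmod.
case: (A 0 0) (A 0 1) (A 1 0) (A 1 1) => [a a'] [b b'] [c c'] [d d'] /=.
set X := (X in 0 <= X).
(* The difference of the squared row norms, squared, plus four times the squared modulus of the
   inner product of the rows. *)
have -> : X = (a ^+ 2 + a' ^+ 2 + b ^+ 2 + b' ^+ 2 - (c ^+ 2 + c' ^+ 2 + d ^+ 2 + d' ^+ 2)) ^+ 2
  + 4 * ((a * c + a' * c' + b * d + b' * d') ^+ 2 + (a * c' - a' * c + b * d' - b' * d) ^+ 2).
  by rewrite /X; ring.
by rewrite addr_ge0 ?sqr_ge0 // mulr_ge0 // addr_ge0 ?sqr_ge0.
Qed.

Lemma sqfrob_ge0 (R : rcfType) (A : 'M[R[i]]_2) : 0 <= sqfrob A.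
Proof. by rewrite addr_ge0 // addr_ge0 // sqmod_ge0. Qed.

Lemma gap2_ge0 (R : rcfType) (A : 'M[R[i]]_2) : 0 <= gap2 A.
Proof.
rewrite subr_ge0 -ler_sqr ?nnegrE ?sqrtr_ge0 ?sqfrob_ge0 // sqr_sqrtr ?gap2_discr_ge0 //.
by rewrite gerBl mulr_ge0 // sqmod_ge0.
Qed.

Lemma gap2_eq0 (R : rcfType) (A : 'M[R[i]]_2) : (gap2 A == 0) = (A \notin unitmx).
Proof.
rewrite unitmxE unitfE negbK subr_eq0.
rewrite -(@eqrXn2 _ 2) ?sqrtr_ge0 ?sqfrob_ge0 // sqr_sqrtr ?gap2_discr_ge0 //.
by rewrite eq_sym -subr_eq0 addrAC subrr sub0r oppr_eq0 mulf_eq0 pnatr_eq0 /= sqmod_eq0.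
Qed.

Lemma spectral_norm_invmx (R : realType) (A : 'M[R[i]]_2) : A \in unitmx ->
  spectral_norm (invmx A) = Num.sqrt (2 / gap2 A).
Proof.
move=> Au; have g_gt0 : 0 < gap2 A.
  by rewrite lt_neqAle eq_sym gap2_eq0 Au gap2_ge0.
set T := sqfrob A; set D := sqmod (\det A); set G := gap2 A in g_gt0 *.
(* [G] is the smaller root of [X^2 - 2 T X + 4 D]; the other is [2 T - G]. *)
have GE : 0 = G ^+ 2 - 2 * T * G + 4 * D.
  rewrite /G /gap2 -/T -/D; have := sqr_sqrtr (gap2_discr_ge0 A); rewrite -/T -/D.
  by set q := Num.sqrt _ => h; lra.
have GT : G <= T by rewrite gerBl sqrtr_ge0.
have svE : singular_values (invmx A) =
    [set s | 0 <= s /\ s ^+ 4 * D - s ^+ 2 * T + 1 = 0].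
  apply/seteqP; split=> s [s0].
    by rewrite eigenvalue_inv_gram // -exprM => /eqP.
  by move=> /eqP sE; split=> //; rewrite eigenvalue_inv_gram // -exprM.
rewrite /spectral_norm svE; set S := [set s | _].
have Smax : S (Num.sqrt (2 / G)).
  split; first exact: sqrtr_ge0.
  have -> : Num.sqrt (2 / G) ^+ 4 = (2 / G) ^+ 2.
    by rewrite (exprM _ 2 2) sqr_sqrtr // divr_ge0 // ltW.
  rewrite sqr_sqrtr ?divr_ge0 ?(ltW g_gt0) //.
  transitivity ((G ^+ 2 - 2 * T * G + 4 * D) / G ^+ 2); last by rewrite -GE mul0r.
  by field; rewrite gt_eqF.
have Sub : ubound S (Num.sqrt (2 / G)).
  move=> s [s0 sE]; rewrite -(ger0_norm s0) -sqrtr_sqr ler_wsqrtr //.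
  rewrite ler_pdivlMr //.
  have D_ge0 : 0 <= D by exact: sqmod_ge0.
  rewrite leNgt; apply/negP => h.
  have s2 : 0 <= s ^+ 2 by rewrite sqr_ge0.
  (* As [G (2 T - G) = 4 D], the equation for [s ^+ 2] has roots [2 / G] and [2 / (2 T - G)], the
     first being the larger since [G <= T]. *)
  have : (s ^+ 2 * G - 2) * (s ^+ 2 * (2 * T - G) - 2) = 0.
    transitivity (4 * (s ^+ 4 * D - s ^+ 2 * T + 1)
        - s ^+ 4 * (G ^+ 2 - 2 * T * G + 4 * D)); first by ring.
    by rewrite sE -GE !mulr0 subr0.
  move/eqP; rewrite mulf_eq0 => /orP[|] /eqP; nra.
apply/eqP; rewrite eq_le; apply/andP; split.
  by apply: ge_sup => //; exists (Num.sqrt (2 / G)).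
by apply: ub_le_sup => //; exists (Num.sqrt (2 / G)).
Qed.

(** * Rows and their Hopf images *)

Lemma alpha_gt0 (R : realType) : 0 < alpha R.
Proof.
rewrite /alpha; have s_gt0 : 0 < Num.sqrt 3 :> R by rewrite sqrtr_gt0.
have : Num.sqrt (3 : R) ^+ 2 = 3 by rewrite sqr_sqrtr.
rewrite subr_gt0 ltr_pdivrMr //; set s := Num.sqrt _ in s_gt0 *; nra.
Qed.

(** The origin of [alpha]: two vectors of length [x] at cosine [-1/3] have a sum of length
    [(2 - alpha) x]. *)
Lemma sqrt_four_thirds (R : realType) (x : R) : 0 <= x ->
  Num.sqrt (4 / 3 * x ^+ 2) = (2 - alpha R) * x.
Proof.
move=> x0; have s_gt0 : 0 < Num.sqrt 3 :> R by rewrite sqrtr_gt0.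
have s2 : Num.sqrt (3 : R) ^+ 2 = 3 by rewrite sqr_sqrtr.
have -> : 2 - alpha R = 2 / Num.sqrt 3 by rewrite /alpha; ring.
rewrite -[RHS]ger0_norm; last by rewrite mulr_ge0 // divr_ge0 // ltW.
rewrite -sqrtr_sqr; congr Num.sqrt.
by rewrite !exprMn exprVn s2; field.
Qed.

Lemma inv_norm_unit (R : realType) (A : 'M[R[i]]_2) : A \in unitmx ->
  inv_norm A = (Num.sqrt (2 / gap2 A))%:E.
Proof. by move=> Au; rewrite /inv_norm Au spectral_norm_invmx. Qed.

(** A singular matrix fits in: its norm is [+oo] and its gap 0. *)
Lemma inv_norm_ge (R : realType) (A : 'M[R[i]]_2) (x : R) : 0 < x ->
  ((Num.sqrt x)%:E <= inv_norm A)%E = (gap2 A <= 2 / x).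
Proof.
move=> x_gt0; have [Au|nAu] := boolP (A \in unitmx).
  have g_gt0 : 0 < gap2 A by rewrite lt_neqAle eq_sym gap2_eq0 Au gap2_ge0.
  rewrite inv_norm_unit // lee_fin ler_sqrt ?divr_ge0 ?(ltW g_gt0) //.
  by rewrite ler_pdivlMr // mulrC -ler_pdivlMr.
rewrite /inv_norm (negPf nAu) leey; move: (nAu); rewrite -gap2_eq0 => /eqP ->.
by rewrite divr_ge0 // ltW.
Qed.

Lemma min_inv_norm_ge (R : realType) (n : nat) (U : 'M[R[i]]_(n, 2)) (x : R) : 0 < x ->
  ((Num.sqrt x)%:E <= min_inv_norm U)%E <->
  (forall i j, i != j -> gap2 (row_pair U i j) <= 2 / x).
Proof.
move=> x_gt0; split.
  by move=> /bigmin_geP[_ h] i j ij; rewrite -inv_norm_ge //; apply: (h (i, j)).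
move=> h; apply: le_bigmin; first by rewrite leey.
by move=> [i j] /= ij; rewrite inv_norm_ge // h.
Qed.

Lemma row_pairE (R : realType) (n : nat) (U : 'M[R[i]]_(n, 2)) (i j : 'I_n) (k : 'I_2) :
  (row_pair U i j 0 k = U i k) * (row_pair U i j 1 k = U j k).
Proof. by rewrite !mxE. Qed.

(** Extends gap bounds from [i != j] to all pairs, and shows that a positive gap needs distinct
    rows. *)
Lemma gap2_row_pair_diag (R : realType) (n : nat) (U : 'M[R[i]]_(n, 2)) (i : 'I_n) :
  gap2 (row_pair U i i) = 0.
Proof.
apply/eqP; rewrite gap2_eq0 unitmxE unitfE negbK det_mx22.
by rewrite !row_pairE [X in _ - X]mulrC subrr.
Qed.

Definition row_sqnorm {R : realType} {n : nat} (U : 'M[R[i]]_(n, 2)) (k : 'I_n) : R :=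
  sqmod (U k 0) + sqmod (U k 1).

Lemma sum_ord3 (V : nmodType) (F : 'I_3 -> V) : \sum_k F k = F 0 + F 1 + F 2.
Proof.
rewrite !big_ord_recl big_ord0 addr0 addrA.
have -> : lift (0 : 'I_3) 0 = 1 by exact/val_inj.
by have -> : lift (0 : 'I_3) (lift (0 : 'I_2) 0) = 2 by exact/val_inj.
Qed.

Definition dot3 {R : pzSemiRingType} (x y : 'rV[R]_3) : R :=
  x 0 0 * y 0 0 + x 0 1 * y 0 1 + x 0 2 * y 0 2.

Lemma hopf_coord (R : realType) (u v : R[i]) :
  [/\ hopf u v 0 0 = 2 * (complex.Re u * complex.Re v + complex.Im u * complex.Im v),
      hopf u v 0 1 = 2 * (complex.Im u * complex.Re v - complex.Re u * complex.Im v) &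
      hopf u v 0 2 = sqmod u - sqmod v].
Proof.
rewrite !mxE !(tnth_nth 0) !normCK -complexiE /sqmod.
by case: u v => [a b] [c d] /=; split; ring.
Qed.

(** In Pauli matrices the Gram matrix of a row is [(r + w . sigma) / 2], so that of a pair has
    eigenvalues [(r_i + r_j +- |w_i + w_j|) / 2]. *)
Lemma gap2_row_pair (R : realType) (n : nat) (U : 'M[R[i]]_(n, 2)) (i j : 'I_n)
    (w := hopf_row U) :
  gap2 (row_pair U i j) = row_sqnorm U i + row_sqnorm U j -
    Num.sqrt ((w i 0 0 + w j 0 0) ^+ 2 + (w i 0 1 + w j 0 1) ^+ 2 + (w i 0 2 + w j 0 2) ^+ 2).
Proof.
rewrite /gap2 /sqfrob det_mx22 !row_pairE /row_sqnorm; congr (_ - Num.sqrt _).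
have [i0 i1 i2] := hopf_coord (U i 0) (U i 1).
have [j0 j1 j2] := hopf_coord (U j 0) (U j 1).
rewrite /w /hopf_row.
transitivity ((2 * (complex.Re (U i 0) * complex.Re (U i 1) + complex.Im (U i 0) * complex.Im (U i 1))
  + 2 * (complex.Re (U j 0) * complex.Re (U j 1) + complex.Im (U j 0) * complex.Im (U j 1))) ^+ 2
  + (2 * (complex.Im (U i 0) * complex.Re (U i 1) - complex.Re (U i 0) * complex.Im (U i 1))
  + 2 * (complex.Im (U j 0) * complex.Re (U j 1) - complex.Re (U j 0) * complex.Im (U j 1))) ^+ 2
  + (sqmod (U i 0) - sqmod (U i 1) + (sqmod (U j 0) - sqmod (U j 1))) ^+ 2); last first.
  by congr ((_ + _) ^+ 2 + (_ + _) ^+ 2 + (_ + _) ^+ 2); apply: esym.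
rewrite /sqmod.
case: (U i 0) (U i 1) (U j 0) (U j 1) => [a a'] [b b'] [c c'] [d d'] /=.
ring.
Qed.

Lemma hopf_row_sqnorm (R : realType) (n : nat) (U : 'M[R[i]]_(n, 2)) (k : 'I_n)
    (w := hopf_row U) :
  row_sqnorm U k ^+ 2 = dot3 (w k) (w k).
Proof.
rewrite /w /hopf_row /row_sqnorm /dot3; have [-> -> ->] := hopf_coord (U k 0) (U k 1).
by rewrite /sqmod; case: (U k 0) (U k 1) => [a a'] [b b'] /=; ring.
Qed.

Lemma row_sqnorm_ge0 (R : realType) (n : nat) (U : 'M[R[i]]_(n, 2)) (k : 'I_n) :
  0 <= row_sqnorm U k.
Proof. by rewrite addr_ge0 // sqmod_ge0. Qed.

Lemma orthonormal_columnsP (R : realType) (n : nat) (U : 'M[R[i]]_(n, 2)) :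
  orthonormal_columns U <->
  [/\ \sum_k sqmod (U k 0) = 1, \sum_k sqmod (U k 1) = 1 &
      \sum_k (U k 0)^* * U k 1 = 0].
Proof.
have gramE a b : ((U ^t*)%sesqui *m U) a b = \sum_k (U k a)^* * U k b.
  by rewrite mxE; apply: eq_bigr => k _; rewrite !mxE.
have diagE a : ((U ^t*)%sesqui *m U) a a = (\sum_k sqmod (U k a))%:C%C.
  by rewrite gramE rmorph_sum; apply: eq_bigr => k _; rewrite -sqmodE.
split=> [UU|[h0 h1 h01]].
  split.
  - by have := diagE 0; rewrite UU mxE eqxx => -[].
  - by have := diagE 1; rewrite UU mxE eqxx => -[].
  - by rewrite -gramE UU mxE.
have h10 : \sum_k (U k 1)^* * U k 0 = 0.
  transitivity ((\sum_k (U k 0)^* * U k 1)^*); last by rewrite h01 conjC0.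
  rewrite rmorph_sum; apply: eq_bigr => k _.
  by rewrite /= rmorphM /= conjCK mulrC.
apply/matrixP => a b; rewrite [RHS]mxE.
have ord2 (x : 'I_2) : x = 0 \/ x = 1.
  by case: x => [[|[|//]] ?]; [left|right]; apply/val_inj.
case: (ord2 a) => ->; case: (ord2 b) => ->; rewrite ?eqxx.
- by rewrite diagE h0.
- by rewrite gramE h01.
- by rewrite gramE h10.
- by rewrite diagE h1.
Qed.

(** In Pauli coordinates the total Gram matrix, being the identity, has trace 2 and no traceless
    part. *)
Lemma sum_hopf_row (R : realType) (n : nat) (U : 'M[R[i]]_(n, 2)) (w := hopf_row U) :
  orthonormal_columns U ->
  [/\ \sum_k row_sqnorm U k = 2, \sum_k w k 0 0 = 0, \sum_k w k 0 1 = 0 &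
      \sum_k w k 0 2 = 0].
Proof.
move=> /orthonormal_columnsP[h0 h1 h01].
have ReD : {morph @complex.Re R : x y / x + y} by move=> [? ?] [? ?].
have ImD : {morph @complex.Im R : x y / x + y} by move=> [? ?] [? ?].
split; first by rewrite big_split /= h0 h1.
- under eq_bigr => k do rewrite (let: And3 e _ _ := hopf_coord (U k 0) (U k 1) in e).
  rewrite -mulr_sumr (_ : \sum_i _ = complex.Re (\sum_k (U k 0)^* * U k 1)).
    by rewrite h01 /= mulr0.
  rewrite (big_morph _ ReD (erefl (complex.Re 0))); apply: eq_bigr => k _.
  by case: (U k 0) (U k 1) => [a a'] [b b'] /=; ring.
- under eq_bigr => k do rewrite (let: And3 _ e _ := hopf_coord (U k 0) (U k 1) in e).
  rewrite -mulr_sumr (_ : \sum_i _ = - complex.Im (\sum_k (U k 0)^* * U k 1)).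
    by rewrite h01 /= oppr0 mulr0.
  rewrite (big_morph _ ImD (erefl (complex.Im 0))) -sumrN; apply: eq_bigr => k _.
  by case: (U k 0) (U k 1) => [a a'] [b b'] /=; ring.
- under eq_bigr => k do rewrite (let: And3 _ _ e := hopf_coord (U k 0) (U k 1) in e).
  by rewrite sumrB h0 h1 subrr.
Qed.

Lemma row_gap_rigidity (R : realType) (n : nat) (U : 'M[R[i]]_(n, 2))
    (w := hopf_row U) (mu : R := 2 / n%:R) :
  (0 < n)%N -> orthonormal_columns U ->
  (forall i j, i != j -> gap2 (row_pair U i j) <= alpha R * mu) ->
  (forall k, row_sqnorm U k = mu) /\
  (forall i j, dot3 (w i) (w j) = mu ^+ 2 \/ dot3 (w i) (w j) = - (mu ^+ 2 / 3)).
Proof.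
move=> n_gt0 /sum_hopf_row[sumr sum0 sum1 sum2] gap.
have mu_gt0 : 0 < mu by rewrite divr_gt0 // ltr0n.
have al_ge0 : 0 <= alpha R by apply: ltW; exact: alpha_gt0.
apply: gap_rigidity => //.
- exact: row_sqnorm_ge0.
- exact: hopf_row_sqnorm.
- by rewrite sumr card_ord /mu mulrC divfK // pnatr_eq0 -lt0n.
- move=> i j; rewrite lerBlDl -lerBlDr -gap2_row_pair.
  have [<-|ij] := eqVneq i j; last exact: gap.
  by rewrite gap2_row_pair_diag mulr_ge0 // ltW.
Qed.

(** * Tetrahedral clusters *)

Lemma dot3_suml (R : pzSemiRingType) (I : Type) (s : seq I) (P : pred I)
    (F : I -> 'rV[R]_3) (y : 'rV[R]_3) :
  dot3 (\sum_(i <- s | P i) F i) y = \sum_(i <- s | P i) dot3 (F i) y.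
Proof. by rewrite /dot3 !summxE !mulr_suml -!big_split. Qed.

Lemma euclidean_distE (R : realType) (x y : 'rV[R]_3) :
  euclidean_dist x y = Num.sqrt (dot3 x x + dot3 y y - 2 * dot3 x y).
Proof. by rewrite /euclidean_dist sum_ord3 /dot3; congr Num.sqrt; ring. Qed.

Lemma dot3_eq (R : realType) (x y : 'rV[R]_3) :
  dot3 x x = dot3 x y -> dot3 y y = dot3 x y -> x = y.
Proof.
move=> xx yy; have : (x 0 0 - y 0 0) ^+ 2 + (x 0 1 - y 0 1) ^+ 2 + (x 0 2 - y 0 2) ^+ 2 = 0.
  transitivity (dot3 x x + dot3 y y - 2 * dot3 x y); first by rewrite /dot3; ring.
  by rewrite xx yy; ring.
move/eqP; rewrite !paddr_eq0 ?addr_ge0 ?sqr_ge0 // !sqrf_eq0 !subr_eq0.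
move=> /andP[/andP[/eqP e0 /eqP e1] /eqP e2]; apply/rowP => k.
have : [|| k == 0, k == 1 | k == 2] by case: k => [[|[|[|//]]] ?].
by move=> /or3P[] /eqP ->.
Qed.

(** If [w i] is taken [k] times, pairing the zero sum with it gives [k q - (n - k) q / 3 = 0], so
    [4 k = n]. The multiplicities add up to [n], hence there are four values. *)
Lemma tetrahedral_clusters_of_dot3 (R : realType) (n : nat) (w : 'I_n -> 'rV[R]_3) (q : R) :
  (0 < n)%N -> 0 < q -> \sum_k w k = 0 ->
  (forall k, dot3 (w k) (w k) = q) ->
  (forall i j, dot3 (w i) (w j) = q \/ dot3 (w i) (w j) = - (q / 3)) ->
  [/\ (4 %| n)%N, tetrahedral_clusters w &
      exists i j, dot3 (w i) (w j) = - (q / 3)].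
Proof.
move=> n_gt0 q_gt0 sumw wkk wij.
have dot_eq i j : w i != w j -> dot3 (w i) (w j) = - (q / 3).
  move=> ne; have [e|//] := wij i j; case/eqP: ne; apply: dot3_eq; rewrite ?wkk //.
have card_sum x : (#|[set j | w j == x]%SET| = \sum_j (w j == x))%N.
  by rewrite -sum1dep_card big_mkcond.
have card4 i : (#|[set j | w j == w i]%SET| * 4)%N = n.
  apply/eqP; rewrite -(eqr_nat R) natrM.
  have : \sum_j dot3 (w j) (w i) = 0 by rewrite -dot3_suml sumw /dot3 !mxE !mul0r !addr0.
  rewrite (eq_bigr (fun j => - (q / 3) + 4 * q / 3 * (w j == w i)%:R)); last first.
    move=> j _; have [->|/dot_eq ->] := eqVneq (w j) (w i); last by rewrite mulr0 addr0.
    by rewrite wkk /= mulr1; field.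
  rewrite big_split /= sumr_const card_ord -mulr_sumr -natr_sum -[X in X + _]mulr_natl.
  rewrite -card_sum.
  set N : R := n%:R; set k : R := #|_|%:R => e.
  have {}e : q * (k * 4 - N) = 0 by lra.
  by move/eqP: e; rewrite mulf_eq0 gt_eqF //= subr_eq0.
have n4 : (4 %| n)%N.
  by apply/dvdnP; exists #|[set j | w j == w (Ordinal n_gt0)]%SET|; rewrite card4.
have cardE i : #|[set j | w j == w i]%SET| = (n %/ 4)%N by rewrite -[in RHS](card4 i) mulnK.
pose s := undup [seq w k | k <- enum 'I_n].
have ws k : w k \in s by rewrite mem_undup map_f // mem_enum.
have size_s : size s = 4.
  have : (\sum_(x <- s) \sum_j (w j == x) = n)%N.
    rewrite exchange_big (eq_bigr (fun=> 1%N)) ?sum1_card ?card_ord // => j _.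
    rewrite (eq_bigr (fun x => if x == w j then 1 else 0)%N); last first.
      by move=> x _; rewrite eq_sym; case: eqP.
    by rewrite -big_mkcond sum1_count count_uniq_mem ?undup_uniq // ws.
  rewrite (eq_big_seq (fun=> n %/ 4)%N); last first.
    by move=> x; rewrite mem_undup => /mapP[k _ ->]; rewrite -card_sum cardE.
  rewrite big_const_seq count_predT iter_addn_0 -[in RHS](divnK n4) mulnC => /eqP.
  by rewrite [RHS in _ == RHS]mulnC eqn_pmul2r ?divn_gt0 ?(dvdn_leq n_gt0) // => /eqP.
pose v (c : 'I_4) := nth 0 s c.
have v_inj a b : v a = v b -> a = b.
  move=> /eqP; rewrite nth_uniq ?undup_uniq ?size_s //; exact: (fun h => val_inj (eqP h)).
have vw c : exists k, w k = v c.
  have : v c \in s by rewrite mem_nth ?size_s.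
  by rewrite mem_undup => /mapP[k _ ->]; exists k.
pose g k : 'I_4 := inord (index (w k) s).
have vg k : v (g k) = w k.
  rewrite /v inordK; first by rewrite nth_index ?ws.
  by rewrite -[X in (_ < X)%N]size_s index_mem ws.
have card_g c : #|[set k | g k == c]%SET| = (n %/ 4)%N.
  have [k0 wk0] := vw c; rewrite -(cardE k0); apply: eq_card => k; rewrite !inE wk0 -vg.
  by apply/eqP/eqP => [->|/v_inj].
split=> //.
  exists g, v; split=> //.
  (* The squared edge is [q + q + 2 q / 3]. *)
  - exists (Num.sqrt (8 * q / 3)); first by rewrite sqrtr_gt0 divr_gt0 // mulr_gt0.
    move=> a b ab; rewrite euclidean_distE.
    have [i wi] := vw a; have [j wj] := vw b; rewrite -wi -wj !wkk dot_eq.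
      by congr Num.sqrt; field.
    by rewrite wi wj; apply: contraNN ab => /eqP/v_inj ->.
  (* Each vertex occurs [n %/ 4] times in the zero sum of the [w k]. *)
  - have : (\sum_c v c) *+ (n %/ 4) = 0.
      rewrite -sumrMnl -[RHS]sumw [RHS](partition_big g xpredT) //=; apply: eq_bigr => c _.
      rewrite [RHS](eq_bigr (fun=> v c)) => [|k /eqP <-]; last by rewrite vg.
      by rewrite sumr_const -(card_g c) cardsE.
    move/rowP => h; apply/rowP => k; have /eqP := h k.
    rewrite mulmxnE mxE mulrn_eq0 => /orP[|/eqP ->] //.
    by rewrite -leqn0 leqNgt divn_gt0 // (dvdn_leq n_gt0 n4).
have [i wi] := vw 0; have [j wj] := vw 1; exists i, j; apply: dot_eq.
by rewrite wi wj; apply/eqP => /v_inj.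
Qed.

(** Centering and equal edges [l] determine all inner products of the vertices, with
    [q = 3 l^2 / 8]. *)
Lemma dot3_of_tetrahedral_clusters (R : realType) (n : nat) (w : 'I_n -> 'rV[R]_3) :
  (0 < n)%N -> (4 %| n)%N -> tetrahedral_clusters w ->
  exists q, [/\ 0 < q, forall k, dot3 (w k) (w k) = q,
    forall i j, dot3 (w i) (w j) = q \/ dot3 (w i) (w j) = - (q / 3) &
    exists i j, i != j /\ dot3 (w i) (w j) = - (q / 3)].
Proof.
move=> n_gt0 n4 [g [v [card_g wv [l l_gt0 vl] sumv]]].
have vab a b : a != b -> 2 * dot3 (v a) (v b) = dot3 (v a) (v a) + dot3 (v b) (v b) - l ^+ 2.
  move=> /vl; rewrite euclidean_distE => <-; rewrite sqr_sqrtr; first by ring.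
  have -> : dot3 (v a) (v a) + dot3 (v b) (v b) - 2 * dot3 (v a) (v b) =
    (v a 0 0 - v b 0 0) ^+ 2 + (v a 0 1 - v b 0 1) ^+ 2 + (v a 0 2 - v b 0 2) ^+ 2.
    by rewrite /dot3; ring.
  by rewrite !addr_ge0 ?sqr_ge0.
pose S := \sum_c dot3 (v c) (v c).
have vaa a : dot3 (v a) (v a) = (3 * l ^+ 2 - S) / 4.
  (* Pairing the zero sum of the vertices with [v a] gives [4 |v_a|^2 + S = 3 l^2]. *)
  have : \sum_c 2 * dot3 (v c) (v a) = 0.
    by rewrite -mulr_sumr -dot3_suml sumv /dot3 !mxE !mul0r !addr0 mulr0.
  rewrite (eq_bigr (fun c => dot3 (v c) (v c) + (dot3 (v a) (v a) - l ^+ 2)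
    + (c == a)%:R * l ^+ 2)); last first.
    move=> c _; have [->|ca] := eqVneq c a; rewrite /=; first by ring.
    by rewrite vab //; ring.
  have delta : \sum_c (c == a)%:R * l ^+ 2 = l ^+ 2.
    by rewrite (bigD1 a) //= eqxx mul1r big1 ?addr0 // => c /negPf ->; rewrite mul0r.
  rewrite big_split big_split /= delta -/S sumr_const card_ord.
  rewrite -(mulr_natr (dot3 (v a) (v a) - l ^+ 2)).
  lra.
have vq a : dot3 (v a) (v a) = 3 * l ^+ 2 / 8.
  have : S = 4 * ((3 * l ^+ 2 - S) / 4).
    rewrite {1}/S (eq_bigr _ (fun a _ => vaa a)) sumr_const card_ord.
    by rewrite -[LHS]mulr_natl.
  by rewrite vaa; lra.
have vne a b : a != b -> dot3 (v a) (v b) = - (3 * l ^+ 2 / 8 / 3).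
  by move=> /vab; rewrite !vq; lra.
have l2 : 0 < l ^+ 2 by rewrite exprn_gt0.
exists (3 * l ^+ 2 / 8); split.
- by rewrite divr_gt0 // mulr_gt0.
- by move=> k; rewrite wv vq.
- move=> i j; rewrite !wv; have [->|] := eqVneq (g i) (g j); first by left.
  by right; apply: vne.
have group c : exists k, g k = c.
  have : (0 < #|[set k | g k == c]%SET|)%N by rewrite card_g divn_gt0 // dvdn_leq.
  by case/card_gt0P => k; rewrite inE => /eqP; exists k.
have [i gi] := group 0; have [j gj] := group 1; exists i, j; split.
  by apply/eqP => ij; move: gj; rewrite -ij gi.
by rewrite !wv vne // gi gj.
Qed.

(** * Gap bounds and the extremal configuration *)

Lemma gap2_row_pair_dot3 (R : realType) (n : nat) (U : 'M[R[i]]_(n, 2)) (mu : R)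
    (w := hopf_row U) :
  0 <= mu -> (forall k, row_sqnorm U k = mu) -> forall i j,
  (dot3 (w i) (w j) = mu ^+ 2 -> gap2 (row_pair U i j) = 0) /\
  (dot3 (w i) (w j) = - (mu ^+ 2 / 3) -> gap2 (row_pair U i j) = alpha R * mu).
Proof.
move=> mu0 rmu i j; rewrite gap2_row_pair -/w !rmu.
have -> : (w i 0 0 + w j 0 0) ^+ 2 + (w i 0 1 + w j 0 1) ^+ 2 + (w i 0 2 + w j 0 2) ^+ 2
    = 2 * mu ^+ 2 + 2 * dot3 (w i) (w j).
  have := hopf_row_sqnorm U i; have := hopf_row_sqnorm U j; rewrite !rmu -/w.
  by clearbody w; rewrite /dot3; lra.
split=> ->.
  have -> : 2 * mu ^+ 2 + 2 * mu ^+ 2 = (2 * mu) ^+ 2 by ring.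
  by rewrite sqrtr_sqr ger0_norm ?mulr_ge0 //; ring.
have -> : 2 * mu ^+ 2 + 2 * - (mu ^+ 2 / 3) = 4 / 3 * mu ^+ 2 by field.
by rewrite sqrt_four_thirds //; ring.
Qed.

(** An upper bound on all gaps already forces the extremal configuration; this serves both the
    existence of a good pair and the case of equality. *)
Lemma clusters_of_small_gaps (R : realType) (n : nat) (U : 'M[R[i]]_(n, 2)) :
  (0 < n)%N -> orthonormal_columns U ->
  (forall i j, i != j -> gap2 (row_pair U i j) <= alpha R * (2 / n%:R)) ->
  [/\ (4 %| n)%N, tetrahedral_clusters (hopf_row U) &
      exists i j, gap2 (row_pair U i j) = alpha R * (2 / n%:R)].
Proof.
move=> n_gt0 UU gap; have [rmu dots] := row_gap_rigidity n_gt0 UU gap.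
have mu_gt0 : 0 < 2 / n%:R :> R by rewrite divr_gt0 // ltr0n.
have [_ sum0 sum1 sum2] := sum_hopf_row UU.
have [//| | | |n4 cl [i [j ij]]] :=
  @tetrahedral_clusters_of_dot3 R n (hopf_row U) ((2 / n%:R) ^+ 2) n_gt0.
- by rewrite exprn_gt0.
- apply/rowP => k; rewrite summxE mxE.
  have : [|| k == 0, k == 1 | k == 2] by case: k => [[|[|[|//]]] ?].
  by move=> /or3P[] /eqP ->.
- by move=> k; rewrite -hopf_row_sqnorm rmu.
- exact: dots.
split=> //; exists i, j.
exact: (gap2_row_pair_dot3 (ltW mu_gt0) rmu i j).2.
Qed.

(** Were all gaps below the threshold, [clusters_of_small_gaps] would produce one equal to it. *)
Lemma exists_large_gap (R : realType) (n : nat) (U : 'M[R[i]]_(n, 2)) :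
  (0 < n)%N -> orthonormal_columns U ->
  exists i j, alpha R * (2 / n%:R) <= gap2 (row_pair U i j).
Proof.
move=> n_gt0 UU; apply: contrapT => /forallNP h.
have small i j : gap2 (row_pair U i j) <= alpha R * (2 / n%:R).
  by rewrite leNgt; apply/negP => /ltW ij; apply: (h i); exists j.
have [_ _ [i [j ij]]] := clusters_of_small_gaps n_gt0 UU (fun i j _ => small i j).
by apply: (h i); exists j; rewrite ij.
Qed.

Lemma gaps_of_clusters (R : realType) (n : nat) (U : 'M[R[i]]_(n, 2)) :
  (0 < n)%N -> (4 %| n)%N -> orthonormal_columns U ->
  tetrahedral_clusters (hopf_row U) ->
  (forall i j, gap2 (row_pair U i j) <= alpha R * (2 / n%:R)) /\
  exists i j, i != j /\ gap2 (row_pair U i j) = alpha R * (2 / n%:R).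
Proof.
move=> n_gt0 n4 UU /(dot3_of_tetrahedral_clusters n_gt0 n4)[q [q_gt0 wkk wij [i [j [ij wq]]]]].
have [sumr _ _ _] := sum_hopf_row UU.
have mu_gt0 : 0 < 2 / n%:R :> R by rewrite divr_gt0 // ltr0n.
have rq k : row_sqnorm U k = Num.sqrt q.
  by rewrite -(wkk k) -hopf_row_sqnorm sqrtr_sqr ger0_norm // row_sqnorm_ge0.
have qmu : Num.sqrt q = 2 / n%:R.
  have n0 : n%:R != 0 :> R by rewrite pnatr_eq0 -lt0n.
  rewrite -sumr (eq_bigr _ (fun k _ => rq k)) sumr_const card_ord -(mulr_natr (Num.sqrt q)).
  by rewrite mulfK.
have rmu k : row_sqnorm U k = 2 / n%:R by rewrite rq.
have qE : q = (2 / n%:R) ^+ 2 by rewrite -qmu sqr_sqrtr // ltW.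
split; last first.
  by exists i, j; split=> //; apply: (gap2_row_pair_dot3 (ltW mu_gt0) rmu i j).2; rewrite -qE.
move=> k l; have [h0 h1] := gap2_row_pair_dot3 (ltW mu_gt0) rmu k l.
have [e|e] := wij k l; last by rewrite h1 // -qE.
by rewrite h0 -?qE // mulr_ge0 ?ltW ?alpha_gt0.
Qed.

(** * Asymptotic tightness *)

(* For [a ^+ 2 + b ^+ 2 = 1] and [6 * (a * b) ^+ 2 = 1] the Hopf images of the four
   rows are the vertices of a regular tetrahedron. *)
Definition tetra_row {R : rcfType} (a b : R) (c : nat) : 'rV[R[i]]_2 :=
  \row_j nth 0 (nth [::] [:: [:: Complex a 0; Complex b 0]; [:: Complex a 0; Complex (- b) 0];
    [:: Complex b 0; Complex 0 a]; [:: Complex b 0; Complex 0 (- a)]] c) j.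

(** Unit rows whose Hopf images have cosine [c] have a determinant of squared modulus [(1 - c) / 2],
    which is [2/3] at [c = -1/3]. *)
Lemma tetra_row_det (R : rcfType) (a b : R) (c d : nat) :
  (c < 4)%N -> (d < 4)%N -> a ^+ 2 + b ^+ 2 = 1 -> 6 * (a * b) ^+ 2 = 1 ->
  let x := tetra_row a b c in let y := tetra_row a b d in
  sqmod (x 0 0 * y 0 1 - x 0 1 * y 0 0) = if c == d then 0 else 2 / 3.
Proof.
move=> c4 d4 ab1 ab2 /=; rewrite !mxE /sqmod.
(* The pairs 0, 1 and 2, 3 give [4 (a b)^2], the other distinct pairs [a^4 + b^4]. *)
have ab4 : a ^+ 4 + b ^+ 4 = 2 / 3.
  have -> : a ^+ 4 + b ^+ 4 = (a ^+ 2 + b ^+ 2) ^+ 2 - 6 * (a * b) ^+ 2 / 3 by field.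
  by rewrite ab1 ab2; field.
have ab22 : 4 * (a * b) ^+ 2 = 2 / 3 by lra.
move: c d c4 d4 => [|[|[|[|//]]]] [|[|[|[|//]]]] _ _ /=; (try by ring);
  (try by rewrite -ab4; ring); by rewrite -ab22; ring.
Qed.

Lemma tetra_row_norm (R : rcfType) (a b : R) (c : nat) :
  (c < 4)%N -> a ^+ 2 + b ^+ 2 = 1 ->
  sqmod (tetra_row a b c 0 0) + sqmod (tetra_row a b c 0 1) = 1.
Proof.
move=> c4 ab1; rewrite !mxE /sqmod -ab1.
by move: c c4 => [|[|[|[|//]]]] _ /=; ring.
Qed.

Lemma sum_mod4 (V : zmodType) (m n : nat) (F : nat -> V) : (4 * m <= n)%N ->
  \sum_(k < n) (if (k < 4 * m)%N then F (k %% 4)%N else 0)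
    = (F 0%N + F 1%N + F 2%N + F 3%N) *+ m.
Proof.
move=> mn; rewrite -big_mkcond -(big_ord_widen _ (fun k => F (k %% 4)%N) mn) /=.
elim: m {mn} => [|m IH]; first by rewrite muln0 big_ord0.
rewrite mulnS addnC !addnS addn0 !big_ord_recr /= IH mulrSr !addrA.
have h j : (j < 4)%N -> ((4 * m + j) %% 4 = j)%N.
  by move=> j4; rewrite mulnC modnMDl modn_small.
have := h 0%N isT; have := h 1%N isT; have := h 2%N isT; have := h 3%N isT.
by rewrite !addnS !addn0 => -> -> -> ->.
Qed.

(* [m] copies of each of the four tetrahedral rows, followed by zero rows. *)
Definition tetra_mx {R : realType} (n m : nat) (a b : R) : 'M[R[i]]_(n, 2) :=
  \matrix_(k < n, j < 2) (if (k < 4 * m)%N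
    then (Complex (Num.sqrt (2 * m)%:R^-1) 0) * tetra_row a b (k %% 4) 0 j else 0).

Lemma tetra_mxE (R : realType) (n m : nat) (a b : R) (k : 'I_n) (j : 'I_2) :
  tetra_mx n m a b k j = if (k < 4 * m)%N
    then (Complex (Num.sqrt (2 * m)%:R^-1) 0) * tetra_row a b (k %% 4) 0 j else 0.
Proof. by rewrite mxE. Qed.

(** With squared scale [1 / (2 m)] the [4 m] unit rows have total squared norm 2, shared equally by
    the columns. *)
Lemma tetra_mx_orthonormal (R : realType) (n m : nat) (a b : R) :
  (0 < m)%N -> (4 * m <= n)%N -> a ^+ 2 + b ^+ 2 = 1 ->
  orthonormal_columns (tetra_mx n m a b).
Proof.
move=> m_gt0 mn ab1; apply/orthonormal_columnsP.
have m0 : m%:R != 0 :> R by rewrite pnatr_eq0 -lt0n.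
set s := Complex (Num.sqrt (2 * m)%:R^-1) 0 : R[i].
have s2 : sqmod s = (2 * m)%:R^-1.
  by rewrite /s /sqmod /= expr0n addr0 sqr_sqrtr // invr_ge0 ler0n.
have sumsq (j : 'I_2) : \sum_k sqmod (tetra_mx n m a b k j) =
   (\sum_(c < 4) sqmod (tetra_row a b c 0 j)) / 2.
  rewrite (eq_bigr (fun k : 'I_n => if (k < 4 * m)%N
    then sqmod s * sqmod (tetra_row a b (k %% 4) 0 j) else 0)); last first.
    by move=> k _; rewrite mxE; case: ifP; rewrite ?sqmod0 // sqmodM.
  rewrite (sum_mod4 (fun k => sqmod s * sqmod (tetra_row a b k 0 j)) mn) s2.
  by rewrite !big_ord_recl big_ord0 /= -mulr_natr natrM; field.
split.
- rewrite sumsq !big_ord_recl big_ord0 !mxE /= /sqmod /=; move: ab1; lra.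
- rewrite sumsq !big_ord_recl big_ord0 !mxE /= /sqmod /=; move: ab1; lra.
- rewrite (eq_bigr (fun k : 'I_n => if (k < 4 * m)%N
    then (s^* * s) * ((tetra_row a b (k %% 4) 0 0)^* * tetra_row a b (k %% 4) 0 1) else 0)); last first.
    by move=> k _; rewrite !mxE; case: ifP; rewrite ?mulr0 // rmorphM /= mulrACA.
  rewrite (sum_mod4 (fun k => (s^* * s) * ((tetra_row a b k 0 0)^* * tetra_row a b k 0 1)) mn).
  rewrite -!mulrDr !mxE /= (_ : _ + _ = 0) ?mulr0 ?mul0rn //.
  by apply/eqP; rewrite eq_complex /=; apply/andP; split; apply/eqP; ring.
Qed.

(** A zero row or two equal rows make the pair singular, with gap 0; any other pair attains the
    bound. *)
Lemma tetra_mx_gap (R : realType) (n m : nat) (a b : R) (i j : 'I_n) :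
  (0 < m)%N -> a ^+ 2 + b ^+ 2 = 1 -> 6 * (a * b) ^+ 2 = 1 ->
  gap2 (row_pair (tetra_mx n m a b) i j) <= alpha R * (2 / (4 * m)%:R).
Proof.
move=> m_gt0 ab1 ab2.
have m_gt0' : 0 < m%:R :> R by rewrite ltr0n.
have bound_ge0 : 0 <= alpha R * (2 / (4 * m)%:R).
  by rewrite mulr_ge0 ?(ltW (alpha_gt0 _)) // divr_ge0 ?ler0n.
have nonunit : sqmod (\det (row_pair (tetra_mx n m a b) i j)) = 0 ->
    gap2 (row_pair (tetra_mx n m a b) i j) <= alpha R * (2 / (4 * m)%:R).
  move=> /eqP; rewrite sqmod_eq0 => d0.
  by rewrite (_ : gap2 _ = 0) //; apply/eqP; rewrite gap2_eq0 unitmxE unitfE d0.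
have [im|im] := boolP (i < 4 * m)%N; last first.
  apply: nonunit; rewrite det_mx22 !row_pairE !mxE (negPf im).
  by rewrite !mul0r subr0 sqmod0.
have [jm|jm] := boolP (j < 4 * m)%N; last first.
  apply: nonunit; rewrite det_mx22 !row_pairE !mxE (negPf jm).
  by rewrite !mulr0 subr0 sqmod0.
set s := Complex (Num.sqrt (2 * m)%:R^-1) 0 : R[i].
have s2 : sqmod s = (2 * m)%:R^-1.
  by rewrite /s /sqmod /= expr0n addr0 sqr_sqrtr // invr_ge0 ler0n.
pose x := tetra_row a b (i %% 4); pose y := tetra_row a b (j %% 4).
have dE : sqmod (\det (row_pair (tetra_mx n m a b) i j)) =
    (2 * m)%:R^-1 ^+ 2 * (if (i %% 4 == j %% 4)%N then 0 else 2 / 3).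
  rewrite -(@tetra_row_det _ a b) ?ltn_mod // -/x -/y -s2 expr2 -!sqmodM.
  rewrite det_mx22 !row_pairE !tetra_mxE im jm -/s -/x -/y.
  by congr sqmod; ring.
have [ij|ij] := boolP (i %% 4 == j %% 4)%N.
  by apply: nonunit; rewrite dE ij mulr0.
rewrite (negPf ij) in dE.
have fE : sqfrob (row_pair (tetra_mx n m a b) i j) = m%:R^-1.
  rewrite /sqfrob !row_pairE !tetra_mxE im jm !sqmodM -/s s2 -!mulrDr.
  by rewrite !tetra_row_norm ?ltn_mod // natrM; field; rewrite gt_eqF.
rewrite /gap2 dE fE.
have -> : m%:R^-1 ^+ 2 - 4 * ((2 * m)%:R^-1 ^+ 2 * (2 / 3)) =
   4 / 3 * ((2 * m)%:R^-1) ^+ 2 :> R.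
  by rewrite natrM; field; rewrite gt_eqF.
rewrite sqrt_four_thirds ?invr_ge0 ?ler0n // le_eqVlt; apply/orP; left; apply/eqP.
by rewrite !natrM; field; rewrite gt_eqF.
Qed.

(** * Inverse norms and the limit *)

Lemma exists_small_inv_norm (R : realType) (n : nat) (U : 'M[R[i]]_(n, 2)) :
  (0 < n)%N -> orthonormal_columns U ->
  exists i j, [/\ i != j, row_pair U i j \in unitmx &
    spectral_norm (invmx (row_pair U i j)) <= Num.sqrt (n%:R / alpha R)].
Proof.
move=> n_gt0 UU; have [i [j ij]] := exists_large_gap n_gt0 UU.
have g_gt0 : 0 < gap2 (row_pair U i j).
  by apply: lt_le_trans ij; rewrite mulr_gt0 ?alpha_gt0 // divr_gt0 // ltr0n.
have Au : row_pair U i j \in unitmx by rewrite -[_ \in _]negbK -gap2_eq0 gt_eqF.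
exists i, j; split=> //.
  by apply/eqP => e; move: g_gt0; rewrite e gap2_row_pair_diag ltxx.
rewrite spectral_norm_invmx // ler_wsqrtr //.
rewrite ler_pdivrMr // (_ : 2 = n%:R / alpha R * (alpha R * (2 / n%:R))).
  by rewrite ler_pM2l // divr_gt0 ?alpha_gt0 // ltr0n.
by field; rewrite (gt_eqF (alpha_gt0 R)) pnatr_eq0 -lt0n n_gt0.
Qed.

Lemma sup_min_inv_norm_le (R : realType) (n : nat) : (0 < n)%N ->
  (sup_min_inv_norm R n <= (Num.sqrt (n%:R / alpha R))%:E)%E.
Proof.
move=> n_gt0; apply: ge_ereal_sup => _ [U UU <-].
have [i [j [ij Au le]]] := exists_small_inv_norm n_gt0 UU.
by apply: (bigmin_inf (i, j)) => //=; rewrite /inv_norm Au lee_fin.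
Qed.

Lemma sup_min_inv_norm_ge (R : realType) (n : nat) : (4 <= n)%N ->
  ((Num.sqrt ((4 * (n %/ 4))%:R / alpha R))%:E <= sup_min_inv_norm R n)%E.
Proof.
move=> n4; set m := (n %/ 4)%N.
have m_gt0 : (0 < m)%N by rewrite divn_gt0.
have s_gt0 : 0 < Num.sqrt 3 :> R by rewrite sqrtr_gt0.
have s2 : Num.sqrt (3 : R) ^+ 2 = 3 by rewrite sqr_sqrtr.
(* [a ^+ 2] and [b ^+ 2] must be the roots [(1 + t) / 2] and [(1 - t) / 2] of [X^2 - X + 1/6]. *)
pose t : R := (Num.sqrt 3)^-1.
have t2 : t ^+ 2 = 3^-1 by rewrite exprVn s2.
have t_ge0 : 0 <= t by rewrite invr_ge0 ltW.
have t_le1 : t <= 1 by nra.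
pose a : R := Num.sqrt ((1 + t) / 2); pose b : R := Num.sqrt ((1 - t) / 2).
have a2 : a ^+ 2 = (1 + t) / 2 by rewrite sqr_sqrtr // divr_ge0 //; lra.
have b2 : b ^+ 2 = (1 - t) / 2 by rewrite sqr_sqrtr // divr_ge0 //; lra.
have ab1 : a ^+ 2 + b ^+ 2 = 1 by rewrite a2 b2; field.
have ab2 : 6 * (a * b) ^+ 2 = 1.
  rewrite exprMn a2 b2; transitivity (6 / 4 * (1 - t ^+ 2)); first by field.
  by rewrite t2; field.
have UU : orthonormal_columns (tetra_mx n m a b).
  by apply: tetra_mx_orthonormal => //; rewrite mulnC leq_trunc_div.
apply: (@le_trans _ _ (min_inv_norm (tetra_mx n m a b))).
  rewrite min_inv_norm_ge; last by rewrite divr_gt0 ?alpha_gt0 // ltr0n muln_gt0.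
  move=> i j _; apply: le_trans (tetra_mx_gap i j m_gt0 ab1 ab2) _.
  by rewrite invf_div mulrCA mulrA.
by apply: ereal_sup_ubound; exists (tetra_mx n m a b).
Qed.

(** [harmonic n] is [1 / (n + 1)]. As [n - 3 <= 4 * (n %/ 4)], a constant [c] works if
    [c (n - 3) >= 3 (n + 1)] for all [n >= 4], which 24 satisfies. *)
Lemma sqrt_div_sup_min_inv_norm_bounds (R : realType) (n : nat) : (4 <= n)%N ->
  (1%:E <= (Num.sqrt (n%:R / alpha R))%:E / sup_min_inv_norm R n
     <= (1 + 24 * harmonic n)%:E)%E.
Proof.
move=> n4; have n_gt0 : (0 < n)%N by apply: leq_trans n4.
have := sup_min_inv_norm_ge R n4; have := sup_min_inv_norm_le R n_gt0.
set x := n%:R / alpha R; set y := (4 * (n %/ 4))%:R / alpha R.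
have al := alpha_gt0 R.
have y_gt0 : 0 < y by rewrite divr_gt0 // ltr0n muln_gt0 divn_gt0.
have x_gt0 : 0 < x by rewrite divr_gt0 // ltr0n.
case: (sup_min_inv_norm R n) => [s| |] //; rewrite !lee_fin => sx ys.
have sy_gt0 : 0 < Num.sqrt y by rewrite sqrtr_gt0.
have s_gt0 : 0 < s by apply: lt_le_trans ys.
rewrite inver gt_eqF // -EFinM !lee_fin ler_pdivlMr // mul1r sx /=.
rewrite ler_pdivrMr //; apply: le_trans (ler_wpM2l _ ys); last first.
  by rewrite addr_ge0 // mulr_ge0 // harmonic_ge0.
set u := 1 + _; have u_ge1 : 1 <= u by rewrite lerDl mulr_ge0 // harmonic_ge0.
have u_ge0 : 0 <= u by apply: le_trans u_ge1.
rewrite -[u]ger0_norm // -sqrtr_sqr -sqrtrM ?sqr_ge0 // ler_wsqrtr //.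
rewrite /x /y mulrA ler_pM2r ?invr_gt0 //.
(* Since [u <= u ^+ 2], it is enough that [n <= u * (4 * (n %/ 4))]. *)
apply: (@le_trans _ _ (u * (4 * (n %/ 4))%:R)); last first.
  by rewrite ler_wpM2r ?ler0n // expr2 ler_peMl.
have hn : (n <= 4 * (n %/ 4) + 3)%N.
  by rewrite {1}(divn_eq n 4) mulnC leq_add2l -ltnS ltn_mod.
move: hn; rewrite -(ler_nat R) natrD => hn.
move: n4; rewrite -(ler_nat R) => n4.
rewrite /u /harmonic; set h : R := _^-1.
have hE : h * (n%:R + 1) = 1 by rewrite /h -natr1 mulVf // natr1 pnatr_eq0.
have h_ge0 : 0 <= h by rewrite invr_ge0 ler0n.
set N : R := n%:R in hn n4 hE *; set M : R := (4 * _)%:R in hn *.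
have : (1 + 24 * h) * (N - 3) <= (1 + 24 * h) * M by apply: ler_wpM2l => //; lra.
nra.
Qed.

Theorem proposition1 (R : realType) :
  [/\ forall (n : nat) (U : 'M[R[i]]_(n, 2)),
        (3 <= n)%N -> orthonormal_columns U ->
        exists i j : 'I_n,
          [/\ i != j, row_pair U i j \in unitmx &
              spectral_norm (invmx (row_pair U i j))
                <= Num.sqrt (n%:R / alpha R)],
      ((Num.sqrt (n%:R / alpha R))%:E / sup_min_inv_norm R n)%E
        @[n --> \oo] --> 1%E &
      forall (n : nat) (U : 'M[R[i]]_(n, 2)),
        (3 <= n)%N -> orthonormal_columns U ->
        (min_inv_norm U = (Num.sqrt (n%:R / alpha R))%:E <->
         (4 %| n)%N /\ tetrahedral_clusters (hopf_row U))].
Proof.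
split.
- move=> n U n3 UU; have n_gt0 : (0 < n)%N by apply: leq_trans n3.
  have [i [j [ij Au le]]] := exists_small_inv_norm n_gt0 UU.
  by exists i, j; split.
- apply: (@squeeze_cvge _ _ _ _ (fun=> 1%:E) _ (fun n => (1 + 24 * harmonic n)%:E)).
  + by near=> n; apply: sqrt_div_sup_min_inv_norm_bounds; near: n; exists 4%N.
  + exact: cvg_cst.
  + apply: cvg_EFin; first exact: nearW.
    rewrite -[X in _ --> X]addr0 -[X in _ --> _ + X](mulr0 24).
    apply: cvgD; first exact: cvg_cst.
    by apply: cvgM; [exact: cvg_cst|exact: cvg_harmonic].
move=> n U n3 UU; have n_gt0 : (0 < n)%N by apply: leq_trans n3.
have x_gt0 : 0 < n%:R / alpha R by rewrite divr_gt0 ?alpha_gt0 // ltr0n.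
have thE : 2 / (n%:R / alpha R) = alpha R * (2 / n%:R) by rewrite invf_div mulrCA mulrA.
split=> [Umin|[n4 cl]].
  suff /(clusters_of_small_gaps n_gt0 UU)[] : forall i j, i != j ->
      gap2 (row_pair U i j) <= alpha R * (2 / n%:R) by [].
  by rewrite -thE; apply/min_inv_norm_ge; rewrite ?Umin.
have [gap [i [j [ij gapij]]]] := gaps_of_clusters n_gt0 n4 UU cl.
apply/eqP; rewrite eq_le; apply/andP; split.
  apply: (bigmin_inf (i, j)) => //=.
  rewrite inv_norm_unit; last first.
    rewrite -[_ \in _]negbK -gap2_eq0 gapij gt_eqF //.
    by rewrite mulr_gt0 ?alpha_gt0 // divr_gt0 // ltr0n.
  by rewrite gapij -thE invf_div mulrCA divff // mulr1.
by apply/min_inv_norm_ge => // k l _; rewrite thE.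
Unshelve. all: by end_near.
Qed.
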